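(* There is a rectangular diagram $R$ of the trivial knot such that every finite sequence of exchange moves and merge moves deforming $R$ into the trivial rectangular diagram (the one with exactly two vertical edges and two horizontal edges) contains an exterior exchange move.
   Context: A rectangular diagram of a link is a link diagram in the plane $\mathbb{R}^2$ composed of vertical line segments and horizontal line segments (called edges), such that no two vertical edges are colinear, no two horizontal edges are colinear, and at each crossing the vertical edge passes over the horizontal edge. It has equally many vertical and horizontal edges. Only the relative order of the vertical edges from left to right and of the horizontal edges from bottom to top matters. Merge moves. If two horizontal (resp. vertical) edges connected by a single vertical (resp. horizontal) edge have no other horizontal (resp. vertical) edges between their ordinates (resp. abscissae), then the three edges can be amalgamated into a single horizontal (resp. vertical) edge; this is an interior horizontal (resp. vertical) merge. If the top and bottom horizontal (resp. leftmost and rightmost vertical) edges are connected by a single vertical (resp. horizontal) edge, then the three edges can be amalgamated into a single horizontal (resp. vertical) edge, placed either at the top height or at the bottom height (resp. either in the leftmost or in the rightmost position); this is an exterior horizontal (resp. vertical) merge. A merge move is any of these; it decreases the number of vertical edges and the number of horizontal edges by one each. Exchange moves. Two vertical edges are interleaved if the heights of their endpoints alternate; two horizontal edges are interleaved if the abscissae of their endpoints alternate. If two horizontal edges at mutually adjacent heights are not interleaved, exchanging their heights (with the vertical edges attached to them lengthened or shortened accordingly) is an interior horizontal exchange. If the top horizontal edge and the bottom horizontal edge are not interleaved, exchanging their heights is an exterior horizontal exchange. Interior and exterior vertical exchanges are defined similarly, with vertical edges adjacent in the left-to-right order, respectively the leftmost and rightmost vertical edges. An exchange move is any of these; an exterior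 exchange move is an exterior horizontal or exterior vertical exchange. *)

(* Defs.v *)
From HB Require Import structures.
From mathcomp Require Import all_boot all_order all_algebra perm.
From mathcomp Require Import all_classical all_reals all_analysis.

Set Implicit Arguments.
Unset Strict Implicit.
Unset Printing Implicit Defensive.

Import Order.TTheory GRing.Theory Num.Theory.
Import numFieldNormedType.Exports.

(* A rectangular diagram, up to the relative order of its edges: the vertical
   edges lie on the lines x = 0, ..., n - 1 and the horizontal edges on the
   lines y = 0, ..., n - 1.  The diagram is recorded by the set of its corners;
   column i holds exactly the two endpoints of the i-th vertical edge and row j
   those of the j-th horizontal edge.  Crossings need no extra data, since the
   vertical edge always passes over. *)
Record rect_diagram (n : nat) := RectDiagram {
  corners : {set 'I_n * 'I_n};
  card_column : forall i : 'I_n, #|[set j | (i, j) \in corners]| = 2;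
  card_row : forall j : 'I_n, #|[set i | (i, j) \in corners]| = 2 }.

Definition vedge n (C : {set 'I_n * 'I_n}) (i j k : 'I_n) : bool :=
  [&& (i, j) \in C, (i, k) \in C & j < k].

Definition hedge n (C : {set 'I_n * 'I_n}) (j a b : 'I_n) : bool :=
  [&& (a, j) \in C, (b, j) \in C & a < b].

Definition transpose n (C : {set 'I_n * 'I_n}) : {set 'I_n * 'I_n} :=
  [set p | (p.2, p.1) \in C].

Inductive position := Interior | Exterior.

Definition in_position (p : position) n (j k : 'I_n) : bool :=
  match p with
  | Interior => (j.+1 == k) || (k.+1 == j)
  | Exterior => ((j == 0 :> nat) && (k.+1 == n)) ||
                ((k == 0 :> nat) && (j.+1 == n))
  end.

(* The alternation is strict: two horizontal edges with endpoints on a common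
   vertical edge are not interleaved. *)
Definition interleaved n (C : {set 'I_n * 'I_n}) (j k : 'I_n) : Prop :=
  exists a b c d : 'I_n,
    [/\ hedge C j a c, hedge C k b d
      & [&& a < b, b < c & c < d] || [&& b < a, a < d & d < c]].

Definition hexchange (p : position) n (C C' : {set 'I_n * 'I_n}) : Prop :=
  exists j k : 'I_n,
    [/\ in_position p j k, j != k, ~ interleaved C j k
      & C' = [set q | (q.1, tperm j k q.2) \in C]].

(* The horizontal edges j and k are joined by the vertical edge i: column i and
   row j disappear, and the remaining endpoint of the edge j moves to row k.
   In the interior case deleting j or k gives the same diagram; in the exterior
   case the two roles give the two allowed placements (top or bottom). *)
Definition hmerge (p : position) n (C : {set 'I_n.+1 * 'I_n.+1})
    (C' : {set 'I_n * 'I_n}) : Prop :=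
  exists i j k : 'I_n.+1,
    [/\ in_position p j k, j != k, (i, j) \in C, (i, k) \in C
      & C' = [set q | ((lift i q.1, lift j q.2) \in C)
                   || (lift j q.2 == k) && ((lift i q.1, j) \in C)]].

Inductive move_kind :=
  | HMerge of position
  | VMerge of position
  | HExchange of position
  | VExchange of position.

Definition is_exterior_exchange (m : move_kind) : bool :=
  match m with
  | HExchange Exterior | VExchange Exterior => true
  | _ => false
  end.

(* Both ends of a move are rectangular diagrams; in particular a merge never
   closes up a component having just two vertical edges. *)
Inductive move : move_kind ->
    forall m n, rect_diagram m -> rect_diagram n -> Prop :=
  | move_hmerge p n (D : rect_diagram n.+1) (D' : rect_diagram n) :
      hmerge p (corners D) (corners D') -> move (HMerge p) D D'
  | move_vmerge p n (D : rect_diagram n.+1) (D' : rect_diagram n) :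
      hmerge p (transpose (corners D)) (transpose (corners D')) ->
      move (VMerge p) D D'
  | move_hexchange p n (D D' : rect_diagram n) :
      hexchange p (corners D) (corners D') -> move (HExchange p) D D'
  | move_vexchange p n (D D' : rect_diagram n) :
      hexchange p (transpose (corners D)) (transpose (corners D')) ->
      move (VExchange p) D D'.

Inductive moves : seq move_kind ->
    forall m n, rect_diagram m -> rect_diagram n -> Prop :=
  | moves_nil n (D : rect_diagram n) : moves [::] D D
  | moves_cons c s m n p (D : rect_diagram m) (E : rect_diagram n)
      (F : rect_diagram p) :
      move c D E -> moves s E F -> moves (c :: s) D F.

Local Open Scope classical_set_scope.
Local Open Scope ring_scope.

(* The link presented by a diagram: the vertical edges are placed at height
   z = 1, the horizontal edges at height z = 0, and each corner becomes a
   segment parallel to the z-axis. *)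
Definition link_of (R : realType) n (D : rect_diagram n) : set (R * R * R) :=
  [set q : R * R * R | exists i j k, vedge (corners D) i j k /\
     [/\ q.1.1 = i%:R, j%:R <= q.1.2 <= k%:R & q.2 = 1]] `|`
  [set q : R * R * R | exists j a b, hedge (corners D) j a b /\
     [/\ a%:R <= q.1.1 <= b%:R, q.1.2 = j%:R & q.2 = 0]] `|`
  [set q : R * R * R | exists i j, (i, j) \in corners D /\
     [/\ q.1.1 = i%:R, q.1.2 = j%:R & 0 <= q.2 <= 1]].

Definition homeomorphism (T U : topologicalType) (f : T -> U) : Prop :=
  continuous f /\
  exists g : U -> T, [/\ cancel f g, cancel g f & continuous g].

Definition ambient_isotopic (R : realType) (A B : set (R * R * R)) : Prop :=
  exists H : R * (R * R * R) -> R * R * R,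
    [/\ {within `[0, 1] `*` setT, continuous H},
        forall t, 0 <= t <= 1 -> homeomorphism (fun x => H (t, x)),
        forall x, H (0, x) = x
      & [set H (1, x) | x in A] = B].

Definition unit_circle (R : realType) : set (R * R * R) :=
  [set q : R * R * R | q.1.1 ^+ 2 + q.1.2 ^+ 2 = 1 /\ q.2 = 0].

Definition trivial_knot (R : realType) (K : set (R * R * R)) : Prop :=
  ambient_isotopic K (@unit_circle R).

Arguments link_of R {n} D.

(* Main.v *)
Require Import Defs.
From mathcomp Require Import all_boot all_order all_algebra.
From mathcomp Require Import all_classical all_reals all_analysis.
From mathcomp Require Import ring lra ssrZ.
From Corelib Require Import BinNums.

(* The diagram has eight rows and columns.  No edge joins two cyclically adjacent
   rows or columns, so no merge applies to it; any two rows or columns that are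
   adjacent in the linear order are interleaved, so no interior exchange applies
   either.  Hence the first move must be an exterior exchange.

   That it is a trivial knot is witnessed by a list of vertex moves on a spatial
   polygon.  Moving a vertex c to c' is realised by an ambient isotopy of the
   form p |-> p + t g(p) (c' - c), where g is a tent: the positive part of a
   minimum of affine forms, equal to 1 at c and vanishing on the edges that do
   not meet c.  Such a map is a homeomorphism as soon as each form has slope
   greater than -1 along c' - c.  The conditions on the forms are inequalities
   between integers, checked by computation.  The polygon ends up as the square
   |x| + |y| = 1 in the plane z = 0, and one more push along the x-axis rounds
   it into the unit circle. *)

Set Implicit Arguments.
Unset Strict Implicit.
Unset Printing Implicit Defensive.

Import Order.TTheory GRing.Theory Num.Theory.
Import numFieldNormedType.Exports.

(** * Diagrams without interior exchanges and merges *)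

Section Grid.

Definition grid n (s : seq (nat * nat)) : {set 'I_n * 'I_n} :=
  [set p | (val p.1, val p.2) \in s].

Definition flip (s : seq (nat * nat)) := [seq (p.2, p.1) | p <- s].

Lemma mem_flip s i j : ((i, j) \in flip s) = ((j, i) \in s).
Proof.
apply/mapP/idP => [[[a b] sab [-> ->]]//|sji]; by exists (j, i).
Qed.

Lemma transpose_grid n s : transpose (grid n s) = grid n (flip s).
Proof. by apply/setP => p; rewrite !inE mem_flip. Qed.

Definition pairs n := [seq (i, j) | i <- iota 0 n, j <- iota 0 n].

Definition triples n := [seq (p, k) | p <- pairs n, k <- iota 0 n].

Lemma mem_pairs n i j : ((i, j) \in pairs n) = (i < n) && (j < n).
Proof.
apply/allpairsP/andP => [[[i' j'] /= [+ + [-> ->]]]|[*]]; first by rewrite !mem_iota.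
by exists (i, j); rewrite !mem_iota.
Qed.

Lemma mem_triples n i j k : ((i, j, k) \in triples n) = [&& i < n, j < n & k < n].
Proof.
rewrite andbA -mem_pairs; apply/allpairsP/andP => [[[p k'] /= [+ + [-> ->]]]|[*]].
  by rewrite mem_iota.
by exists ((i, j), k); rewrite mem_iota.
Qed.

Definition two_per_column n (s : seq (nat * nat)) :=
  all (fun i => count (fun j => (i, j) \in s) (iota 0 n) == 2) (iota 0 n).

Lemma card_ord_count n (P : pred nat) : #|[set j : 'I_n | P j]| = count P (iota 0 n).
Proof.
rewrite cardsE cardE /enum_mem size_filter -val_enum_ord count_map enumT.
exact: eq_count.
Qed.

Lemma card_column_grid n s : two_per_column n s ->
  forall i : 'I_n, #|[set j | (i, j) \in grid n s]| = 2.
Proof.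
move=> /allP s2 i; have /s2/eqP <- : val i \in iota 0 n by rewrite mem_iota ltn_ord.
by rewrite -card_ord_count; apply: eq_card => j; rewrite !inE.
Qed.

Lemma card_row_grid n s : two_per_column n (flip s) ->
  forall j : 'I_n, #|[set i | (i, j) \in grid n s]| = 2.
Proof.
move=> s2 j; rewrite -(card_column_grid s2 j); apply: eq_card => i.
by rewrite !inE /= mem_flip.
Qed.

(* The triple (i, j, k) stands for the edge of column i from row j to row k. *)
Definition vertical (s : seq (nat * nat)) (t : nat * nat * nat) :=
  [&& (t.1.1, t.1.2) \in s, (t.1.1, t.2) \in s & t.1.2 < t.2].

Definition row (s : seq (nat * nat)) n j :=
  [seq p <- pairs n | vertical (flip s) (j, p.1, p.2)].

Definition alternating n s j k :=
  has (fun p => has (fun q => [&& p.1 < q.1, q.1 < p.2 & p.2 < q.2] ||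
      [&& q.1 < p.1, p.1 < q.2 & q.2 < p.2]) (row s n k)) (row s n j).

(* The conditions are symmetric in the two rows, so one order suffices. *)
Definition rigid n s :=
  all (fun t : nat * nat * nat =>
    let: (i, j, k) := t in
    ((j.+1 == k) || (j == 0) && (k.+1 == n)) ==>
    ~~ (((i, j) \in s) && ((i, k) \in s)) &&
    ((j.+1 == k) ==> alternating n s j k)) (triples n).


Lemma interleaved_alternating n s (j k : 'I_n) :
  alternating n s j k -> interleaved (grid n s) j k.
Proof.
rewrite /row => /hasP[[a c] + /hasP[[b d]]].
rewrite !mem_filter !mem_pairs /vertical /= !mem_flip.
move=> /andP[ac /andP[an cn]] /andP[bd /andP[bn dn]] alt.
exists (Ordinal an), (Ordinal bn), (Ordinal cn), (Ordinal dn); split=> //.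
  by rewrite /hedge !inE.
by rewrite /hedge !inE.
Qed.

Lemma interleavedC n (C : {set 'I_n * 'I_n}) j k : interleaved C j k -> interleaved C k j.
Proof.
by move=> [a [b [c [d [h1 h2 h]]]]]; exists b, a, d, c; split=> //; rewrite orbC.
Qed.

Lemma rigid_hexchange n s C' : rigid n s -> ~ hexchange Interior (grid n s) C'.
Proof.
move=> /allP rs [j [k [jk _ nil _]]].
have adj (j' k' : 'I_n) : j'.+1 == k' -> interleaved (grid n s) j' k'.
  move=> jk'; apply: interleaved_alternating.
  have := rs (val j', val j', val k'); rewrite mem_triples !ltn_ord => /(_ isT).
  by rewrite jk' => /andP[].
by case/orP: jk => /adj // /interleavedC.
Qed.

Lemma rigid_hmerge p n s C' : rigid n.+1 s -> ~ @hmerge p n (grid n.+1 s) C'.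
Proof.
move=> /allP rs [i [j [k [jk _ +  + _]]]]; rewrite !inE /= => ij ik.
have adj (j' k' : 'I_n.+1) : (j'.+1 == k') || (j' == 0 :> nat) && (k'.+1 == n.+1) ->
    (val i, val j') \in s -> (val i, val k') \in s -> False.
  move=> jk' ij' ik'; have := rs (val i, val j', val k').
  by rewrite mem_triples !ltn_ord jk' ij' ik' => /(_ isT).
by case: p jk => /= /orP[] jk;
  [apply: adj ij ik | apply: adj ik ij | apply: adj ij ik | apply: adj ik ij];
  rewrite jk ?orbT.
Qed.

(** Transposition turns vertical moves into horizontal ones, so the row conditions on [s] and on
    [flip s] cover the four kinds of moves. *)
Lemma rigid_move c m n (D : rect_diagram m) (E : rect_diagram n) s :
  move c D E -> corners D = grid m s -> rigid m s -> rigid m (flip s) ->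
  is_exterior_exchange c.
Proof.
case=> {c m n D E} p n D E h Ds rs rfs; rewrite Ds ?transpose_grid in h.
- by have := rigid_hmerge rs h.
- by have := rigid_hmerge rfs h.
- by case: p h => // /(rigid_hexchange rs).
- by case: p h => // /(rigid_hexchange rfs).
Qed.

(** The sizes differ, so the sequence has a first move, and by rigidity that move is already an
    exterior exchange. *)
Lemma rigid_moves l m n (D : rect_diagram m) (E : rect_diagram n) s :
  moves l D E -> corners D = grid m s -> rigid m s -> rigid m (flip s) ->
  m != n -> has is_exterior_exchange l.
Proof.
case=> {l m n D E} [n D _ _ _ /eqP//|c l m n p D E F DE _ Ds rs rfs _].
by rewrite /= (rigid_move DE Ds).
Qed.

End Grid.

Local Open Scope classical_set_scope.
Local Open Scope ring_scope.

(** * Isotopies moving points along parallel lines *)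

Definition shift (K : pzRingType) (e : K * K * K) (s : K) (p : K * K * K) :=
  (p.1.1 + s * e.1.1, p.1.2 + s * e.1.2, p.2 + s * e.2).

Lemma shiftD (K : pzRingType) (e : K * K * K) s t p :
  shift e s (shift e t p) = shift e (t + s) p.
Proof. by rewrite /shift/= !mulrDl !addrA. Qed.

Lemma shift0 (K : pzRingType) (e p : K * K * K) : shift e 0 p = p.
Proof. by case: p => -[x y] z; rewrite /shift !mul0r !addr0. Qed.

Section Push.
Variable R : realType.
Implicit Types (e p : R * R * R) (g : R * R * R -> R) (s t : R).

Lemma continuous_pair (X Y Z : topologicalType) (f : X -> Y) (g : X -> Z) :
  continuous f -> continuous g -> continuous (fun x => (f x, g x)).
Proof. by move=> cf cg x; exact: cvg_pair (cf x) (cg x). Qed.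

Lemma continuous_shift (X : topologicalType) e (f : X -> R)
    (h : X -> R * R * R) :
  continuous f -> continuous h -> continuous (fun x => shift e (f x) (h x)).
Proof.
move=> cf ch; have coord (a : R) (k : R * R * R -> R) : continuous k ->
    continuous (fun y => k (h y) + f y * a).
  move=> ck x; apply: (@continuousD R R X (k \o h)).
    by apply: continuous_comp; [exact: ch | exact: ck].
  apply: (@continuousM R X f (cst a)); first exact: cf.
  exact: cst_continuous.
apply: continuous_pair; first apply: continuous_pair.
- apply: (coord _ (fun p => p.1.1)) => y.
  by apply: (@continuous_comp _ _ _ fst fst); exact: cvg_fst.
- apply: (coord _ (fun p => p.1.2)) => y.
  by apply: (@continuous_comp _ _ _ fst snd); [exact: cvg_fst | exact: cvg_snd].
- by apply: (coord _ snd) => y; exact: cvg_snd.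
Qed.

(** At [r x - eps] and [r x + eps] the function has strict opposite signs. These persist for
    parameters near [x], and monotonicity traps the root [r y] between the two points. *)
Lemma continuous_root (X : topologicalType) (F : X -> R -> R) (r : X -> R) :
  (forall s, continuous (F ^~ s)) ->
  (forall x, {homo F x : s t / s < t}) ->
  (forall x, F x (r x) = 0) -> continuous r.
Proof.
move=> cF mF Fr x; apply/cvgrPdist_lt => eps eps0.
have lo : F x (r x - eps) < 0 by rewrite -(Fr x) mF// ltrBlDr ltrDl.
have hi : 0 < F x (r x + eps) by rewrite -(Fr x) mF// ltrDl.
near=> y; have lt_lo : F y (r x - eps) < 0.
  by near: y; apply: cvgr_lt lo; exact: cF.
have lt_hi : 0 < F y (r x + eps).
  by near: y; apply: cvgr_gt hi; exact: cF.
have lt_mF := leW_mono (le_mono (mF y)).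
rewrite distrC ltr_distl -(lt_mF (_ - _)) -(lt_mF (r y)) Fr.
by rewrite lt_lo lt_hi.
Unshelve. all: by end_near. Qed.

(** These are conditions at time 1 on each line parallel to [e]. The sign of [s] itself is included
    so that the bounds survive interpolation with the identity at earlier times. *)
Record pushable e g : Prop := Pushable {
  push_continuous : continuous g;
  push_homo : forall p, {homo (fun s => s + g (shift e s p)) : s t / s < t};
  push_low : forall p, exists2 s, s <= 0 & s + g (shift e s p) <= 0;
  push_high : forall p, exists2 s, 0 <= s & 0 <= s + g (shift e s p) }.

Definition push e g t p := shift e (t * g p) p.

Lemma continuous_push e g : continuous g ->
  continuous (fun q : R * (R * R * R) => push e g q.1 q.2).
Proof.
move=> cg; apply: continuous_shift => q.
  apply: continuousM; first exact: cvg_fst.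
  by apply: continuous_comp; [exact: cvg_snd | exact: cg].
exact: cvg_snd.
Qed.

Lemma continuous_push_at e g t : continuous g -> continuous (push e g t).
Proof.
move=> cg; apply: continuous_shift => p; last exact: cvg_id.
by apply: continuousM; [exact: cst_continuous | exact: cg].
Qed.

(** The preimage of [p] is [shift e s p], where [s] is the root of [s + t * g (shift e s p)]. The
    root exists by the intermediate value theorem, is unique by strict monotonicity, and depends
    continuously on [p]. *)
Lemma push_homeomorphism e g t :
  pushable e g -> 0 <= t <= 1 -> homeomorphism (push e g t).
Proof.
move=> [cg homo_g low high] /andP[t0 t1].
pose F p s := s + t * g (shift e s p).
(* A convex combination of the identity and the time-one function: monotonicity and signs pass from
   time 1 to time [t]. *)
have FE p s : F p s = (1 - t) * s + t * (s + g (shift e s p)).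
  by rewrite /F; ring.
have mF p : {homo F p : s s' / s < s'}.
  move=> s s' ss'; rewrite !FE; have gss' := homo_g p _ _ ss'.
  move: t1; rewrite le_eqVlt => /predU1P[->|t1].
    by rewrite subrr !mul0r !add0r !mul1r.
  by rewrite ltr_leD// ?ltr_pM2l ?subr_gt0// ler_wpM2l// ltW.
have cF s : continuous (F ^~ s).
  move=> p; apply: (@continuousD _ _ _ (cst s) (fun p => t * g (shift e s p))).
    exact: cst_continuous.
  apply: (@continuousM _ _ (cst t) (g \o shift e s)); first exact: cst_continuous.
  apply: continuous_comp; last exact: cg.
  by apply: (@continuous_shift _ e (cst s) id) => ?;
    [exact: cst_continuous | exact: cvg_id].
have cFp p : continuous (F p).
  move=> s; apply: (@continuousD _ _ _ id (fun s => t * g (shift e s p))).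
    exact: cvg_id.
  apply: (@continuousM _ _ (cst t) (g \o (fun s => shift e s p))).
    exact: cst_continuous.
  apply: continuous_comp; last exact: cg.
  by apply: (@continuous_shift _ e id (cst p)) => ?;
    [exact: cvg_id | exact: cst_continuous].
have rootP p : exists s, F p s = 0.
  have [s1 s1_le0 Fs1] := low p; have [s2 s2_ge0 Fs2] := high p.
  have lo : F p s1 <= 0 by rewrite FE; nra.
  have hi : 0 <= F p s2 by rewrite FE; nra.
  have [|||s _ Fs] := @IVT _ (F p) s1 s2 0; first exact: le_trans s2_ge0.
  - exact: continuous_subspaceT.
  - by rewrite ge_min le_max lo hi orbT.
  by exists s.
pose r p := projT1 (cid (rootP p)).
have Fr p : F p (r p) = 0 by rewrite /r; case: cid.
split; first exact: continuous_push_at.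
exists (fun p => shift e (r p) p); split=> [p|p|].
- rewrite /push shiftD; suff -> : r (shift e (t * g p) p) = - (t * g p).
    by rewrite subrr shift0.
  have Fp : F (shift e (t * g p) p) (- (t * g p)) = 0.
    by rewrite /F shiftD subrr shift0 addNr.
  set q := shift e _ p in Fp *; case: (ltgtP (r q) (- (t * g p))) => // /(mF q);
    by rewrite Fp Fr ltxx.
- rewrite /push shiftD; set x := shift e (r p) p.
  by have := Fr p; rewrite /F -/x => ->; rewrite shift0.
apply: continuous_shift => p; last exact: cvg_id.
exact: (continuous_root cF mF Fr).
Qed.

(* Unlike [ambient_isotopic], this asks for continuity at all times, so that two
   isotopies can be composed at each time instead of being concatenated. *)
Definition isotopic (A B : set (R * R * R)) :=
  exists H : R * (R * R * R) -> R * R * R,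
    [/\ continuous H,
        forall t, 0 <= t <= 1 -> homeomorphism (fun x => H (t, x)),
        forall x, H (0, x) = x
      & [set H (1, x) | x in A] = B].

Lemma isotopic_ambient A B : isotopic A B -> ambient_isotopic A B.
Proof.
by move=> [H [cH *]]; exists H; split=> //; exact: continuous_subspaceT.
Qed.

Lemma isotopic_push e g A : pushable e g -> isotopic A [set push e g 1 x | x in A].
Proof.
move=> pg; exists (fun q => push e g q.1 q.2); split=> //.
- by apply: continuous_push; case: pg.
- by move=> t t01; exact: push_homeomorphism.
- by move=> x; rewrite /push/= mul0r shift0.
Qed.

Lemma isotopic_refl A : isotopic A A.
Proof.
exists snd; split=> //.
- by move=> x; exact: cvg_snd.
- move=> t _; split; first by move=> x; exact: cvg_id.
  by exists id; split=> // x; exact: cvg_id.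
- by apply/seteqP; split=> [x [y Ay <-]//|x Ax]; exists x.
Qed.

Lemma isotopic_trans B A C : isotopic A B -> isotopic B C -> isotopic A C.
Proof.
move=> [H [cH hH H0 <-]] [K [cK hK K0 <-]].
exists (fun q => K (q.1, H q)); split.
- move=> q; apply: (@continuous_comp _ _ _ (fun q => (q.1, H q)) K); last exact: cK.
  by apply: (@continuous_pair _ _ _ fst H) => // x; exact: cvg_fst.
- move=> t t01; have [cHt [H' [HK' KH' cH']]] := hH _ t01.
  have [cKt [K' [KK' K'K cK']]] := hK _ t01.
  split.
    move=> x; apply: (@continuous_comp _ _ _ (fun x => H (t, x)) (fun x => K (t, x)));
      [exact: cHt | exact: cKt].
  exists (H' \o K'); split=> [x|x|x] /=.
  + by rewrite KK' HK'.
  + by rewrite KH' K'K.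
  + by apply: continuous_comp; [exact: cK' | exact: cH'].
- by move=> x; rewrite H0 K0.
- by rewrite image_comp.
Qed.

End Push.

(** * Tents *)

Definition vec (K : pzRingType) (p q : K * K * K) :=
  (q.1.1 - p.1.1, q.1.2 - p.1.2, q.2 - p.2).

Definition dot (K : pzRingType) (u v : K * K * K) :=
  u.1.1 * v.1.1 + u.1.2 * v.1.2 + u.2 * v.2.

Definition eval (K : pzRingType) (l : K * K * K * K) (p : K * K * K) :=
  dot l.1 p + l.2.

Lemma eval_shift (K : comPzRingType) (l : K * K * K * K) e s p :
  eval l (shift e s p) = eval l p + s * dot l.1 e.
Proof. by rewrite /eval /dot /=; ring. Qed.

Lemma dot_vec (K : comPzRingType) (l : K * K * K * K) p q :
  dot l.1 (vec p q) = eval l q - eval l p.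
Proof. by rewrite /eval /dot /=; ring. Qed.

Section Tent.
Variable R : realType.
Implicit Types (e p q a b c : R * R * R) (l : R * R * R * R).

Definition lowest l0 (ls : seq (R * R * R * R)) p :=
  foldr (fun l m => Num.min (eval l p) m) (eval l0 p) ls.

Definition tent l0 ls p := Num.max 0 (lowest l0 ls p).

Lemma le_lowest x l0 ls p :
  (x <= lowest l0 ls p) = all (fun l => x <= eval l p) (l0 :: ls).
Proof.
by elim: ls => /= [|l ls]; rewrite ?andbT// le_min => -> /=; rewrite andbCA.
Qed.

Lemma lowest_le l0 ls p : {in l0 :: ls, forall l, lowest l0 ls p <= eval l p}.
Proof.
by apply/allP; rewrite -le_lowest.
Qed.

Lemma continuous_eval l : continuous (eval l).
Proof.
have cfst (X Y : topologicalType) : continuous (@fst X Y) by move=> ?; exact: cvg_fst.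
have csnd (X Y : topologicalType) : continuous (@snd X Y) by move=> ?; exact: cvg_snd.
have c (k : R * R * R -> R) x : continuous k -> continuous (fun p => x * k p).
  move=> ck p; apply: (@continuousM _ _ (cst x) k); last exact: ck.
  exact: cst_continuous.
have cD (f g : R * R * R -> R) :
    continuous f -> continuous g -> continuous (fun p => f p + g p).
  by move=> cf cg p; apply: (@continuousD R R _ f g); [exact: cf | exact: cg].
apply: (cD _ (cst l.2)); last by move=> ?; exact: cst_continuous.
apply: (cD (fun p => _ * p.1.1 + _ * p.1.2) (fun p => _ * p.2)); last exact/c/csnd.
apply: (cD (fun p => _ * p.1.1) (fun p => _ * p.1.2)); apply: (c) => p.
  by apply: continuous_comp; exact: cfst.
by apply: continuous_comp; [exact: cfst | exact: csnd].
Qed.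

Lemma continuous_tent l0 ls : continuous (tent l0 ls).
Proof.
move=> p; apply: (@continuous_max _ _ (cst 0) (lowest l0 ls)).
  exact: cst_continuous.
elim: ls => [|l ls IH]; first exact: continuous_eval.
by apply: (@continuous_min _ _ (eval l) (lowest l0 ls)) => //; exact: continuous_eval.
Qed.

(* A slope greater than -1 in the direction of the push keeps the points of a
   line parallel to [e] in order. *)
Lemma pushable_tent e l0 ls :
  all (fun l => -1 < dot l.1 e) (l0 :: ls) -> pushable e (tent l0 ls).
Proof.
move=> /= /andP[l0e lse]; split; first exact: continuous_tent.
- move=> p s t st.
  have ev l : -1 < dot l.1 e ->
      s + eval l (shift e s p) < t + eval l (shift e t p).
    by rewrite !eval_shift => le; nra.
  have low : s + lowest l0 ls (shift e s p) < t + lowest l0 ls (shift e t p).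
    elim: ls lse => [_|l ls IH /= /andP[le /IH {}IH]]; first exact: ev.
    rewrite !addr_minr lt_min !gt_min; apply/andP.
    by split; apply/orP; [left; exact: ev | right].
  rewrite /tent !addr_maxr !addr0 gt_max !lt_max; apply/andP.
  by split; apply/orP; [left | right].
- move=> p; pose m := dot l0.1 e; have m1 : 0 < 1 + m by rewrite -ltrBlDl sub0r.
  (* A single form bounds the minimum from above. Its sum with [s] is [eval l0 p + s * (1 + m)],
     which is at most 0 for this [s]. *)
  exists (Num.min 0 (- eval l0 p / (1 + m))); first by rewrite ge_min lexx.
  set s := Num.min _ _; have s0 : s <= 0 by rewrite ge_min lexx.
  have sm : s * (1 + m) <= - eval l0 p by rewrite -ler_pdivlMr// ge_min lexx orbT.
  have := @lowest_le l0 ls (shift e s p) l0 (mem_head _ _).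
  rewrite eval_shift -/m /tent addr_maxr addr0 ge_max s0 => le /=.
  by apply: le_trans (_ : s + (eval l0 p + s * m) <= 0); rewrite ?lerD2l//; nra.
- by move=> p; exists 0 => //; rewrite add0r /tent le_max lexx.
Qed.

Definition seg p q := [set shift (vec p q) t p | t in `[0, 1]].

Lemma segC p q : seg p q = seg q p.
Proof.
suff sub p' q' : seg p' q' `<=` seg q' p' by apply/seteqP; split; exact: sub.
move=> _ [t /= + <-]; rewrite in_itv/= => /andP[t0 t1].
exists (1 - t); first by rewrite /= in_itv/=; apply/andP; split; lra.
by rewrite /shift /vec/=; congr (_, _, _); ring.
Qed.

Lemma seg_midpoint p q m : vec p m = vec m q -> seg p m `|` seg m q = seg p q.
Proof.
case: p q m => -[p1 p2] p3 [[q1 q2] q3] [[m1 m2] m3] [] /= e1 e2 e3.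
have -> : q1 = m1 + (m1 - p1) by rewrite e1; ring.
have -> : q2 = m2 + (m2 - p2) by rewrite e2; ring.
have -> : q3 = m3 + (m3 - p3) by rewrite e3; ring.
apply/seteqP; split.
  move=> _ [] [t /= + <-]; rewrite in_itv/= => /andP[t0 t1].
    exists (t / 2); first by rewrite /= in_itv/=; apply/andP; split; lra.
    by rewrite /shift /vec/=; congr (_, _, _); field.
  exists ((1 + t) / 2); first by rewrite /= in_itv/=; apply/andP; split; lra.
  by rewrite /shift /vec/=; congr (_, _, _); field.
move=> _ [t /= + <-]; rewrite in_itv/= => /andP[t0 t1].
have [t2|t2] := lerP t (1 / 2); [left; exists (2 * t) | right; exists (2 * t - 1)].
- by rewrite /= in_itv/=; apply/andP; split; lra.
- by rewrite /shift /vec/=; congr (_, _, _); field.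
- by rewrite /= in_itv/=; apply/andP; split; lra.
- by rewrite /shift /vec/=; congr (_, _, _); field.
Qed.

(** Where the tent is positive, both forms are. The first then bounds the parameter of the point
    from below, the second from above, and the product condition makes the two bounds incompatible.
    So the tent vanishes on the segment. *)
Lemma push_tent_fixed e l0 ls l l' p q : l \in l0 :: ls -> l' \in l0 :: ls ->
  eval l p <= 0 -> eval l' q <= 0 -> eval l' p * eval l q <= eval l p * eval l' q ->
  [set push e (tent l0 ls) 1 x | x in seg p q] = seg p q.
Proof.
move=> ll l'l lp l'q lpq.
suff fix_seg y : seg p q y -> push e (tent l0 ls) 1 y = y.
  apply/seteqP; split=> [_ [x xpq <-]|x xpq]; first by rewrite fix_seg.
  by exists x; rewrite ?fix_seg.
move=> [t /= + <-]; rewrite in_itv/= => /andP[t0 t1]; set x := shift _ _ _.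
suff x0 : lowest l0 ls x <= 0 by rewrite /push /tent max_l// mulr0 shift0.
rewrite leNgt; apply/negP => x0.
have lx : 0 < eval l x := lt_le_trans x0 (lowest_le x ll).
have l'x : 0 < eval l' x := lt_le_trans x0 (lowest_le x l'l).
move: lx l'x; rewrite !eval_shift !dot_vec.
move: (eval l p) (eval l' p) (eval l q) (eval l' q) lp l'q lpq => g al d be.
move=> g0 be0 ald lx l'x.
have {}lx : (1 - t) * - g < t * d by lra.
have {}l'x : t * - be < (1 - t) * al by lra.
have := ltr_pM _ _ lx l'x; rewrite !mulr_ge0 ?oppr_ge0 ?subr_ge0// => /(_ isT isT).
have k0 : 0 <= t * (1 - t) by rewrite mulr_ge0// subr_ge0.
have := ler_wpM2l k0 ald; lra.
Qed.

(** At parameter [t] of the leg each form is [(1 - t) * eval k a + t], at least [t], with equality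
    for a form vanishing at [a]. So the tent equals [t] there, and the image is the point of
    parameter [t] on the new leg. *)
Lemma push_tent_leg l0 ls a c c' :
  all (fun l => eval l c == 1) (l0 :: ls) -> all (fun l => 0 <= eval l a) (l0 :: ls) ->
  has (fun l => eval l a == 0) (l0 :: ls) ->
  [set push (vec c c') (tent l0 ls) 1 x | x in seg a c] = seg a c'.
Proof.
move=> /allP lc /allP la /hasP[l ll /eqP la0].
suff leg t : 0 <= t <= 1 -> push (vec c c') (tent l0 ls) 1 (shift (vec a c) t a) =
    shift (vec a c') t a.
  apply/seteqP; split=> [_ [_ [t t01 <-] <-]|_ [t t01 <-]].
    by exists t => //; rewrite leg//; move: t01; rewrite /= in_itv.
  exists (shift (vec a c) t a); first by exists t.
  by rewrite leg//; move: t01; rewrite /= in_itv.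
move=> /andP[t0 t1]; suff -> : push (vec c c') (tent l0 ls) 1 (shift (vec a c) t a) =
    shift (vec c c') t (shift (vec a c) t a).
  by rewrite /shift /vec/=; congr (_, _, _); ring.
rewrite /push mul1r; congr (shift _ _ _); rewrite /tent.
have ev k : k \in l0 :: ls -> eval k (shift (vec a c) t a) = (1 - t) * eval k a + t.
  by move=> /lc/eqP kc; rewrite eval_shift dot_vec kc; ring.
have -> : lowest l0 ls (shift (vec a c) t a) = t.
  apply/eqP; rewrite eq_le; apply/andP; split.
    by apply: le_trans (lowest_le _ ll) _; rewrite ev// la0 mulr0 add0r.
  rewrite le_lowest; apply/allP => k kl; rewrite ev//.
  by have := la _ kl; nra.
by rewrite max_r.
Qed.

End Tent.

(** * Moving the vertices of a polygon *)

(* Integer points are placed at scale 1/4, which leaves room for midpoints and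
   for further vertices between the lattice points of a diagram. *)
Notation point := (Z * Z * Z)%type.

Definition cross (u v : point) : point :=
  (u.1.2 * v.2 - u.2 * v.1.2, u.2 * v.1.1 - u.1.1 * v.2,
   u.1.1 * v.1.2 - u.1.2 * v.1.1).

(* Affine forms over a common denominator, cutting out a thin neighbourhood of
   the triangles a c c' and b c c'.  In the coordinates of
   c + alpha (a - c) + beta (b - c) + gamma f they are
   1 - x alpha - y beta - z gamma.  Weights 7/8 instead of 1 keep the slope along
   c' - c above -1, also when c' is the midpoint of a and b; weights of absolute
   value 16 make the tent steep on the other sides.  The vector f is c' - c, or
   a normal vector if c' lies in the plane of a, b and c. *)
Definition bump (a c b c' : point) : Z * seq (point * Z) :=
  let u := vec c a in let v := vec c b in let e := vec c c' in
  let n := cross u v in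
  let: (f, r) := if dot n e == 0 then (n, 128) else (e, 7) in
  let d := dot n f in
  let s : Z := if d < 0 then -1 else 1 in
  let form (q : Z * Z * Z) :=
    let w := shift (cross v f) (- s * q.1.1) (0, 0, 0) in
    let w := shift (cross f u) (- s * q.1.2) w in
    let w := shift n (- s * q.2) w in
    (w, 8 * s * d - dot w c) in
  (8 * s * d, [seq form (q, z) | q <- [:: (8, 7); (7, 8); (8, -128); (-128, 8)],
                                 z <- [:: r; -128]]).

(** Here [T] is the common denominator. Positivity at [c'], after the value [T] at [c], is the slope
    bound along [c' - c]; the other conditions make the tent affine on the leg from [a] to [c]. *)
Definition leg_ok (fs : seq (point * Z)) (T : Z) (a c c' : point) :=
  [&& all (fun l => eval l c == T) fs, all (fun l => 0 < eval l c') fs,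
      all (fun l => 0 <= eval l a) fs & has (fun l => eval l a == 0) fs].

(* On a segment, two affine forms whose positive parts have disjoint supports:
   the first form is nonpositive at one end, the second one at the other end,
   and the products compare the positions of their zeros. *)
Definition avoids (fs : seq (point * Z)) (e : point * point) :=
  has (fun l => (eval l e.1 <= 0) &&
    has (fun l' => (eval l' e.2 <= 0) &&
      (eval l' e.1 * eval l e.2 <= eval l e.1 * eval l' e.2)) fs) fs.

(** Edges are oriented, so that [a] is the predecessor and [b] the successor of [c]. The forms
    proposed by [bump] are accepted only after explicit tests, hence soundness requires no property
    of [bump]. *)
Definition step (s : seq (point * point)) (m : point * point) :=
  let: (c, c') := m in
  match [seq e.1 | e <- s & e.2 == c], [seq e.2 | e <- s & e.1 == c] with
  | [:: a], [:: b] =>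
    let: (T, fs) := bump a c b c' in
    let rest := [seq e <- s | (e.1 != c) && (e.2 != c)] in
    if [&& 0 < T, leg_ok fs T a c c', leg_ok fs T b c c' & all (avoids fs) rest]
    then Some ((if vec a c' == vec c' b then [:: (a, b)] else [:: (a, c'); (c', b)])
               ++ rest)
    else None
  | _, _ => None
  end.

Definition run s ms := foldl (fun o m => obind (step ^~ m) o) (Some s) ms.

Section Link.
Variable R : realType.

Definition toR (z : Z) : R := (int_of_Z z)%:~R.

Lemma toR_ge0 z : 0 <= z -> 0 <= toR z.
Proof. by case: z => // p _; rewrite /toR ler0z. Qed.

Lemma toRB : {morph toR : x y / x - y}.
Proof. by move=> x y; rewrite /toR !rmorphB. Qed.

Lemma toR0 : toR 0%R = 0.
Proof. by rewrite /toR !rmorph0. Qed.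

Lemma toR_nat n : toR n%:R = n%:R.
Proof. by rewrite /toR !rmorph_nat. Qed.

Lemma toRD : {morph toR : x y / x + y}.
Proof. by move=> x y; rewrite /toR !rmorphD. Qed.

Lemma toRM : {morph toR : x y / x * y}.
Proof. by move=> x y; rewrite /toR !rmorphM. Qed.

Lemma le_toR x y : x <= y -> toR x <= toR y.
Proof. by move=> xy; rewrite -subr_ge0 -toRB toR_ge0// subr_ge0. Qed.

Lemma lt_toR x y : x < y -> toR x < toR y.
Proof.
move=> xy; rewrite lt_neqAle le_toR ?ltW// andbT.
by rewrite /toR eqr_int (can_eq int_of_ZK) lt_eqF.
Qed.

Definition emb (p : point) : R * R * R :=
  (toR p.1.1 / 4, toR p.1.2 / 4, toR p.2 / 4).

(** The factor 4 cancels the scale of [emb]; the division by [T] normalises the value [T] to 1. *)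
Definition form (T : Z) (l : point * Z) : R * R * R * R :=
  (4 * toR l.1.1.1 / toR T, 4 * toR l.1.1.2 / toR T, 4 * toR l.1.2 / toR T,
   toR l.2 / toR T).

Lemma eval_emb T l p : 0 < T -> eval (form T l) (emb p) = toR (eval l p) / toR T.
Proof.
move=> /lt_toR/gt_eqF T0; rewrite /eval /dot /form /emb /= !(toRD, toRM).
by field; rewrite T0.
Qed.

Definition edges_set (s : seq (point * point)) : set (R * R * R) :=
  [set x | exists2 e, e \in s & seg (emb e.1) (emb e.2) x].

Lemma edges_set_cons e s :
  edges_set (e :: s) = seg (emb e.1) (emb e.2) `|` edges_set s.
Proof.
apply/seteqP; split=> x.
  by move=> [e']; rewrite inE => /predU1P[->|e's] ?; [left | right; exists e'].
by move=> [?|[e' e's ?]]; [exists e | exists e'] => //; rewrite inE ?eqxx ?e's ?orbT.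
Qed.

Lemma edges_set_nil : edges_set [::] = set0.
Proof. by apply/seteqP; split=> x // -[]. Qed.

Lemma edges_set_corner s c a b :
  [seq e.1 | e <- s & e.2 == c] = [:: a] -> [seq e.2 | e <- s & e.1 == c] = [:: b] ->
  edges_set s =
    edges_set [:: (a, c), (c, b) & [seq e <- s | (e.1 != c) && (e.2 != c)]].
Proof.
move=> sa sb.
have in1 e : e \in s -> e.2 = c -> e = (a, c).
  case: e => x y es /= yc; have : x \in [seq e.1 | e <- s & e.2 == c].
    by apply/mapP; exists (x, y) => //; rewrite mem_filter es andbT; exact/eqP.
  by rewrite sa inE yc => /eqP ->.
have in2 e : e \in s -> e.1 = c -> e = (c, b).
  case: e => x y es /= xc; have : y \in [seq e.2 | e <- s & e.1 == c].
    by apply/mapP; exists (x, y) => //; rewrite mem_filter es andbT; exact/eqP.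
  by rewrite sb inE xc => /eqP ->.
have acs : (a, c) \in s.
  have : a \in [seq e.1 | e <- s & e.2 == c] by rewrite sa mem_head.
  by case/mapP => -[x y]; rewrite mem_filter /= => /andP[/eqP -> ?] ->.
have cbs : (c, b) \in s.
  have : b \in [seq e.2 | e <- s & e.1 == c] by rewrite sb mem_head.
  by case/mapP => -[x y]; rewrite mem_filter /= => /andP[/eqP -> ?] ->.
apply/seteqP; split=> x [e es xe]; exists e => //; last first.
  move: es; rewrite !inE => /or3P[/eqP->|/eqP->|] //.
  by rewrite mem_filter => /andP[].
rewrite !inE mem_filter es andbT.
have [/(in1 _ es) ->|e2] := eqVneq e.2 c; first by rewrite eqxx.
by have [/(in2 _ es) ->|e1] := eqVneq e.1 c; rewrite ?eqxx ?orbT.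
Qed.

Lemma emb_midpoint a b m : vec a m = vec m b -> vec (emb a) (emb m) = vec (emb m) (emb b).
Proof.
by move=> [e1 e2 e3]; rewrite /vec /emb /= -!mulrBl -!toRB e1 e2 e3.
Qed.

Lemma image_edges_set (f : R * R * R -> R * R * R) s :
  (forall e, e \in s ->
    [set f x | x in seg (emb e.1) (emb e.2)] = seg (emb e.1) (emb e.2)) ->
  [set f x | x in edges_set s] = edges_set s.
Proof.
elim: s => [_|e s IH fs]; first by rewrite edges_set_nil image_set0.
rewrite edges_set_cons image_setU fs ?mem_head// IH// => e' e's.
by apply: fs; rewrite inE e's orbT.
Qed.

Lemma step_isotopic s m s' : step s m = Some s' -> isotopic (edges_set s) (edges_set s').
Proof.
case: m => c c'; rewrite /step.
case sa: [seq e.1 | e <- s & _] => [//|a [|//]].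
case sb: [seq e.2 | e <- s & _] => [//|b [|//]].
(* The forms are arbitrary from here on. An empty list fails the test for a form vanishing at
   [a]. *)
case: bump => T [|l0 ls]; first by rewrite /leg_ok /= !andbF.
set rest := [seq e <- s | _]; case: ifP => // /and4P[T0 legs_a legs_b rest_ok] [<-].
rewrite (edges_set_corner sa sb) -/rest.
pose e := vec (emb c) (emb c'); pose g := tent (form T l0) (map (form T) ls).
have T0' : 0 < toR T := lt_toR T0.
have [/allP lc /allP lc' _ _] := and4P legs_a.
have leg x : leg_ok (l0 :: ls) T x c c' ->
    [set push e g 1 y | y in seg (emb x) (emb c)] = seg (emb x) (emb c').
  move=> /and4P[_ _ /allP lx0 /hasP[l ll lx]]; apply: push_tent_leg.
  - rewrite -map_cons all_map; apply/allP => k /lc /eqP kc /=.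
    by rewrite eval_emb// kc divff// gt_eqF.
  - rewrite -map_cons all_map; apply/allP => k /lx0 kx /=.
    by rewrite eval_emb// divr_ge0// ?toR_ge0// ltW.
  - rewrite -map_cons has_map; apply/hasP; exists l => //=.
    by rewrite eval_emb// (eqP lx) /toR rmorph0 mul0r.
have pg : pushable e g.
  apply: pushable_tent; rewrite -map_cons all_map; apply/allP => k kl /=.
  rewrite -/(form T k) /e (dot_vec (form T k)) !eval_emb// (eqP (lc _ kl)) divff ?gt_eqF//.
  by rewrite -subr_gt0 opprK subrK divr_gt0// (lt_toR (lc' _ kl)).
suff <- : [set push e g 1 x | x in edges_set [:: (a, c), (c, b) & rest]] =
    edges_set ((if vec a c' == vec c' b then [:: (a, b)] else [:: (a, c'); (c', b)])
               ++ rest).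
  exact: isotopic_push.
rewrite !edges_set_cons !image_setU leg// [seg (emb c) _]segC leg//.
rewrite [seg (emb b) _]segC image_edges_set.
  case: eqP => [mid|_]; rewrite !edges_set_cons//= setUA seg_midpoint//.
  exact: emb_midpoint.
move=> -[p q] /(allP rest_ok) /hasP[l ll /andP[lp /hasP[l' l'l /andP[l'q lpq]]]].
apply: (@push_tent_fixed _ _ _ _ (form T l) (form T l')); rewrite -?map_cons ?map_f//.
- by rewrite eval_emb// pmulr_lle0 ?invr_gt0//; exact: (le_toR lp).
- by rewrite eval_emb// pmulr_lle0 ?invr_gt0//; exact: (le_toR l'q).
rewrite !eval_emb// mulrACA [leRHS]mulrACA ler_wpM2r//.
  by rewrite -invfM invr_ge0 mulr_ge0// ltW.
by rewrite -!toRM le_toR.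
Qed.

Lemma run_isotopic s ms s' : run s ms = Some s' -> isotopic (edges_set s) (edges_set s').
Proof.
rewrite /run; elim: ms s => [|m ms IH] s /=; first by move=> [<-]; exact: isotopic_refl.
case sm: (step s m) => [t|]; last by elim: ms {IH}.
by move=> /IH; apply: isotopic_trans; exact: step_isotopic sm.
Qed.

End Link.

(** * From a square to a circle *)

Section Circle.
Variable R : realType.

(* The graph of the circular arc over [0, 1], extended by the line of slope 1,
   minus the diagonal. *)
Definition bulge (x : R) : R :=
  Num.sqrt (1 - (1 - Num.min 1 x) ^+ 2) - Num.min 1 x.

(** The odd extension of [bulge] from the nonnegative half-line, as a function of the first
    coordinate. *)
Definition round (p : R * R * R) : R :=
  bulge (Num.max 0 p.1.1) - bulge (Num.max 0 (- p.1.1)).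

Lemma bulge0 : bulge 0 = 0.
Proof. by rewrite /bulge min_r// !subr0 expr1n subrr sqrtr0. Qed.

Lemma bulge_ge1 x : 1 <= x -> bulge x = 0.
Proof. by move=> x1; rewrite /bulge min_l// subrr expr0n subr0 sqrtr1 subrr. Qed.

Lemma bulge_le1 x : x <= 1 -> x + bulge x = Num.sqrt (1 - (1 - x) ^+ 2).
Proof. by move=> x1; rewrite /bulge min_r// addrC subrK. Qed.

(** The sum is the height of the circular arc on [0, 1], which increases, and the identity beyond 1.
    If [x] is below 1, it is first compared with the height at [Num.min 1 y]. *)
Lemma bulge_homo x y : 0 <= x -> x < y -> x + bulge x < y + bulge y.
Proof.
move=> x0 xy; have [x1|x1] := leP 1 x.
  by rewrite !bulge_ge1 ?addr0// (le_trans x1)// ltW.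
rewrite bulge_le1 ?ltW//.
apply: (@lt_le_trans _ _ (Num.sqrt (1 - (1 - Num.min 1 y) ^+ 2))).
  have : x < Num.min 1 y <= 1 by rewrite lt_min x1 xy ge_min lexx.
  by move: (Num.min 1 y) => z /andP[xz z1]; rewrite ltr_sqrt; nra.
by rewrite /bulge addrCA lerDl subr_ge0 ge_min lexx orbT.
Qed.

Lemma continuous_bulge : continuous bulge.
Proof.
have cmin : continuous (fun x : R => Num.min 1 x).
  move=> x; apply: (@continuous_min _ _ (cst 1) id); last exact: cvg_id.
  exact: cst_continuous.
have c1 (f : R -> R) : continuous f -> continuous (fun x => 1 - f x : R).
  move=> cf y; apply: (@continuousB R R R (cst 1) f); last exact: cf.
  exact: cst_continuous.
move=> x; apply: (@continuousB R R R
  (fun x : R => Num.sqrt (1 - (1 - Num.min 1 x) ^+ 2) : R) (fun x : R => Num.min 1 x : R));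
  last exact: cmin.
apply: (@continuous_comp R R R (fun x : R => 1 - (1 - Num.min 1 x) ^+ 2) (@Num.sqrt R));
  last exact: sqrt_continuous.
apply: (c1 (fun x => (1 - Num.min 1 x) ^+ 2)) => y.
by apply: (@continuousM R R (fun x : R => 1 - Num.min 1 x) (fun x : R => 1 - Num.min 1 x));
  exact: c1.
Qed.

Lemma pushable_round : pushable (1, 0, 0) round.
Proof.
(* With [y] the shifted first coordinate, [x - y] is constant along the line. Monotonicity thus
   reduces to that of [u + bulge u] on the positive and negative parts, one of them strictly. *)
have Exy x y : x + (bulge (Num.max 0 y) - bulge (Num.max 0 (- y))) =
    (x - y) + ((Num.max 0 y + bulge (Num.max 0 y)) -
               (Num.max 0 (- y) + bulge (Num.max 0 (- y)))).
  have : Num.max 0 y - Num.max 0 (- y) = y by rewrite !maxEle; do 2 case: ifP; lra.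
  by move: (bulge _) (bulge _) => *; lra.
have homo x y : x < y ->
    Num.max 0 x + bulge (Num.max 0 x) <= Num.max 0 y + bulge (Num.max 0 y).
  move=> xy; have : Num.max 0 x <= Num.max 0 y.
    by rewrite ge_max !le_max lexx (ltW xy) orbT.
  by rewrite le_eqVlt => /predU1P[->//|?]; rewrite ltW// bulge_homo// le_max lexx.
have zero x : 1 <= `|x| -> bulge (Num.max 0 x) - bulge (Num.max 0 (- x)) = 0.
  move=> x1; case/orP: (le_total 0 x) => x0.
    rewrite ger0_norm// in x1; rewrite (max_r x0) max_l ?oppr_le0// bulge0 subr0.
    exact: bulge_ge1.
  rewrite ler0_norm// in x1; rewrite (max_l x0) max_r ?oppr_ge0// bulge0 sub0r.
  by rewrite bulge_ge1 ?oppr0.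
split.
- have cc (f : R * R * R -> R) :
      continuous f -> continuous (fun p => bulge (Num.max 0 (f p))).
    move=> cf p; apply: (@continuous_comp _ _ _ (fun p => Num.max 0 (f p)) bulge).
      by apply: (@continuous_max _ _ (cst 0) f); [exact: cst_continuous | exact: cf].
    exact: continuous_bulge.
  have cx : continuous (fun p : R * R * R => p.1.1).
    by move=> q; apply: (@continuous_comp _ _ _ fst fst); exact: cvg_fst.
  move=> p; apply: (@continuousB R R _ (fun p : R * R * R => bulge (Num.max 0 p.1.1))
    (fun p : R * R * R => bulge (Num.max 0 (- p.1.1)))).
    exact: (cc (fun p => p.1.1)).
  apply: (cc (fun p => - p.1.1)) => q.
  by apply: (@continuousN R R _ (fun p => p.1.1)); exact: cx.
- move=> -[[x y] z] s t st; rewrite /round /shift /= !mulr1 !Exy.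
  have xst : x + s < x + t by rewrite ltrD2l.
  case: (boolP (0 < x + t)) => [x0|]; last rewrite -leNgt => x0.
    have -> : Num.max 0 (x + t) = x + t by rewrite max_r// ltW.
    have m0 : Num.max 0 (- (x + t)) = 0 by rewrite max_l// oppr_le0 ltW.
    rewrite m0 bulge0 !addr0.
    have := @bulge_homo (Num.max 0 (x + s)) (x + t); rewrite le_max lexx gt_max x0 xst.
    move=> /(_ isT isT); have := homo (- (x + t)) (- (x + s)); rewrite ltrN2 => /(_ xst).
    rewrite m0 bulge0; lra.
  have xs0 : x + s < 0 by apply: lt_le_trans x0.
  rewrite (max_l (ltW xs0)) (max_l x0) !max_r ?oppr_ge0 ?(ltW xs0)//.
  have := @bulge_homo (- (x + t)) (- (x + s)).
  by rewrite oppr_ge0 x0 ltrN2 xst => /(_ isT isT); lra.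
(* This shift brings the first coordinate to absolute value at least 1, where [round] vanishes. *)
- move=> -[[x y] z]; exists (- (1 + `|x|)); first by rewrite oppr_le0 addr_ge0.
  rewrite /round /shift /= mulr1 zero ?addr0 ?oppr_le0 ?addr_ge0//.
  by rewrite ler_normr; apply/orP; right; have := ler_norm x; lra.
- move=> -[[x y] z]; exists (1 + `|x|); first by rewrite addr_ge0.
  rewrite /round /shift /= mulr1 zero ?addr0 ?addr_ge0//.
  by rewrite ler_normr; apply/orP; left; have := ler_norm (- x); rewrite normrN; lra.
Qed.

(** Order and orientation of the edges are those left by the last move of [isotopy_moves], so that
    the result of [run] agrees literally. *)
Definition diamond : seq (point * point) :=
  [:: ((0, 4, 0), (4, 0, 0)); ((4, 0, 0), (0, -4, 0));
      ((0, -4, 0), (-4, 0, 0)); ((-4, 0, 0), (0, 4, 0))].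

Lemma diamondE :
  @edges_set R diamond = [set q | `|q.1.1| + `|q.1.2| = 1 /\ q.2 = 0].
Proof.
rewrite /diamond !edges_set_cons edges_set_nil setU0.
have r4 : @toR R 4%R / 4 = 1 by rewrite toR_nat divff.
have r0 : @toR R 0%R / 4 = 0 by rewrite (toR0 R) mul0r.
have rN4 : @toR R (- 4)%R / 4 = -1.
  by rewrite -[- 4]sub0r toRB (toR0 R) toR_nat sub0r mulNr divff.
rewrite /emb /= r4 r0 rN4 /seg /vec /shift /=.
apply/seteqP; split=> [[[x y] z]|[[x y] z] /= [xy ->]].
  by move=> [|[|[|]]] [t /=]; rewrite in_itv/= => /andP[t0 t1] [<- <- <-];
    (split; [do 2 (case: ger0P => ?); lra | ring]).
have [x0|x0] := leP 0 x; have [y0|y0] := leP 0 y.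
- left; exists x; rewrite /= ?in_itv/=; move: xy; rewrite !ger0_norm// => xy.
    by apply/andP; split; lra.
  by congr (_, _, _); lra.
- right; left; exists (- y); rewrite /= ?in_itv/=; move: xy;
    rewrite ger0_norm// ltr0_norm// => xy.
    by apply/andP; split; lra.
  by congr (_, _, _); lra.
- right; right; right; exists y; rewrite /= ?in_itv/=; move: xy;
    rewrite ltr0_norm// ger0_norm// => xy.
    by apply/andP; split; lra.
  by congr (_, _, _); lra.
- right; right; left; exists (- x); rewrite /= ?in_itv/=; move: xy;
    rewrite !ltr0_norm// => xy.
    by apply/andP; split; lra.
  by congr (_, _, _); lra.
Qed.

Lemma diamond_isotopic : isotopic (@edges_set R diamond) (@unit_circle R).
Proof.
rewrite diamondE; set A := [set q | _].
suff <- : [set push (1, 0, 0) round 1 x | x in A] = @unit_circle R.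
  exact/isotopic_push/pushable_round.
(* On the square [1 - |x|] is [|y|], so the arc height over [|x|] is the square root of
   [1 - y ^+ 2]. *)
have E x y : `|x| + `|y| = 1 -> push (1, 0, 0) round 1 (x, y, 0) =
    ((if 0 <= x then 1 else -1) * Num.sqrt (1 - y ^+ 2), y, 0) :> R * R * R.
  move=> xy; rewrite /push /shift /round /= !mulr0 !addr0 mul1r mulr1.
  have y2 : y ^+ 2 = (1 - `|x|) ^+ 2.
    by rewrite -[LHS]real_normK ?num_real//; congr (_ ^+ 2); lra.
  rewrite y2; have x1 : `|x| <= 1 by rewrite -xy lerDl.
  case: ifP => [x0|/negbT]; last rewrite -ltNge => x0.
    rewrite ger0_norm// in x1 *; rewrite (max_r x0) max_l ?oppr_le0// bulge0 subr0.
    by rewrite mul1r -bulge_le1.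
  rewrite ltr0_norm// in x1 *; rewrite (max_l (ltW x0)) max_r ?oppr_ge0 ?ltW// bulge0 sub0r.
  by rewrite mulN1r -bulge_le1//; congr (_, _, _); ring.
apply/seteqP; split=> [_ [[[x y] z] [/= xy ->] <-]|[[x y] z] [/= xy ->]].
  rewrite E//; split=> //=; rewrite exprMn sqr_sqrtr.
    by case: ifP => _; rewrite ?sqrrN expr1n; ring.
  rewrite subr_ge0 -real_normK ?num_real// exprn_ile1//.
  by rewrite -xy lerDr.
have yx : 1 - y ^+ 2 = `|x| ^+ 2 by rewrite real_normK ?num_real//; lra.
have [x0|x0] := leP 0 x.
  have y1 : `|y| <= 1.
    rewrite -(@ler_pXn2r _ 2) ?nnegrE// real_normK ?num_real// expr1n.
    by rewrite -subr_ge0 yx sqr_ge0.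
  exists (1 - `|y|, y, 0); first by split=> //=; rewrite ger0_norm ?subr_ge0 ?subrK.
  rewrite E; last by rewrite ger0_norm ?subr_ge0 ?subrK.
  rewrite subr_ge0 y1 mul1r yx.
  by rewrite sqrtr_sqr normr_id ger0_norm.
(* Strictness makes the first coordinate [|y| - 1] of the preimage negative, which selects the
   branch -1 in [E]. *)
have y1 : `|y| < 1.
  rewrite -(@ltr_pXn2r _ 2) ?nnegrE// real_normK ?num_real// expr1n.
  by rewrite -subr_gt0 yx exprn_gt0// normr_gt0 lt_eqF.
exists (`|y| - 1, y, 0); first by split=> //=; rewrite ltr0_norm ?subr_lt0//; lra.
rewrite E; last by rewrite ltr0_norm ?subr_lt0//; lra.
by rewrite leNgt subr_lt0 y1 /= yx sqrtr_sqr normr_id ltr0_norm// mulN1r opprK.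
Qed.

End Circle.

(** * The diagram *)

Definition lattice (i j h : nat) : point := ((4 * i)%:R, (4 * j)%:R, (4 * h)%:R).

Definition grid_edges n s : seq (point * point) :=
  [seq (lattice t.1.1 t.1.2 1, lattice t.1.1 t.2 1) | t <- triples n & vertical s t] ++
  [seq (lattice t.1.2 t.1.1 0, lattice t.2 t.1.1 0)
    | t <- triples n & vertical (flip s) t] ++
  [seq (lattice p.1 p.2 0, lattice p.1 p.2 1) | p <- pairs n & p \in s].

(** Orientation is ignored: [grid_edges] directs edges by increasing coordinates, whereas [step]
    needs a cyclically oriented polygon. *)
Definition same_edges (s t : seq (point * point)) :=
  all (fun e => (e \in t) || ((e.2, e.1) \in t)) s &&
  all (fun e => (e \in s) || ((e.2, e.1) \in s)) t.

Section GridLink.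
Variable R : realType.

Lemma same_edges_set s t : same_edges s t -> edges_set s = edges_set t :> set (R * R * R).
Proof.
suff sub s' t' : all (fun e => (e \in t') || ((e.2, e.1) \in t')) s' ->
    (edges_set s' : set (R * R * R)) `<=` edges_set t'.
  by move=> /andP[st ts]; apply/seteqP; split; exact: sub.
move=> /allP st x [e /st/orP[et|et] ex]; first by exists e.
by exists (e.2, e.1) => //; rewrite segC.
Qed.

Lemma emb_lattice i j h : emb R (lattice i j h) = (i%:R, j%:R, h%:R).
Proof.
by rewrite /emb /lattice /= !toR_nat !natrM ![4 * _]mulrC !mulfK.
Qed.

Lemma segment_param (a b y : R) : a <= b ->
  (a <= y <= b) <-> exists2 t, 0 <= t <= 1 & a + t * (b - a) = y.
Proof.
move=> ab; split=> [/andP[ay yb]|[t /andP[t0 t1] <-]]; last by apply/andP; split; nra.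
have [ba|ba] := eqVneq (b - a) 0.
  by exists 0; rewrite ?lexx ?ler01//; lra.
have ba0 : 0 < b - a by rewrite lt_def ba subr_ge0.
exists ((y - a) / (b - a)); last by rewrite divfK// addrC subrK.
by rewrite divr_ge0 ?subr_ge0//= ler_pdivrMr// mul1r lerD2r.
Qed.

Lemma seg_coord1 (a b y z : R) : a <= b ->
  seg (a, y, z) (b, y, z) = [set q | [/\ a <= q.1.1 <= b, q.1.2 = y & q.2 = z]].
Proof.
move=> ab; rewrite /seg /vec /shift /= !subrr.
apply/seteqP; split=> [_ [t /= + <-]|[[x1 x2] x3] [/= + -> ->]].
  rewrite in_itv/= => t01; rewrite /= !mulr0 !addr0; split=> //.
  by apply/segment_param => //; exists t.
by move/segment_param => /(_ ab)[t t01 <-]; exists t; rewrite /= ?in_itv// !mulr0 !addr0.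
Qed.

Lemma seg_coord2 (a b x z : R) : a <= b ->
  seg (x, a, z) (x, b, z) = [set q | [/\ q.1.1 = x, a <= q.1.2 <= b & q.2 = z]].
Proof.
move=> ab; rewrite /seg /vec /shift /= !subrr.
apply/seteqP; split=> [_ [t /= + <-]|[[x1 x2] x3] [/= -> + ->]].
  rewrite in_itv/= => t01; rewrite /= !mulr0 !addr0; split=> //.
  by apply/segment_param => //; exists t.
by move/segment_param => /(_ ab)[t t01 <-]; exists t; rewrite /= ?in_itv// !mulr0 !addr0.
Qed.

Lemma seg_coord3 (a b x y : R) : a <= b ->
  seg (x, y, a) (x, y, b) = [set q | [/\ q.1.1 = x, q.1.2 = y & a <= q.2 <= b]].
Proof.
move=> ab; rewrite /seg /vec /shift /= !subrr.
apply/seteqP; split=> [_ [t /= + <-]|[[x1 x2] x3] [/= -> -> +]].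
  rewrite in_itv/= => t01; rewrite /= !mulr0 !addr0; split=> //.
  by apply/segment_param => //; exists t.
by move/segment_param => /(_ ab)[t t01 <-]; exists t; rewrite /= ?in_itv// !mulr0 !addr0.
Qed.

Lemma edges_set_cat s t :
  edges_set (s ++ t) = edges_set s `|` edges_set t :> set (R * R * R).
Proof.
elim: s => [|e s IH]; first by rewrite edges_set_nil set0U.
by rewrite cat_cons !edges_set_cons IH setUA.
Qed.

Lemma edges_set_map (T : eqType) (f : T -> point * point) (s : seq T) :
  edges_set (map f s) =
    [set x : R * R * R | exists2 t, t \in s & seg (emb R (f t).1) (emb R (f t).2) x].
Proof.
apply/seteqP; split=> x [e]; first by move=> /mapP[t ts ->]; exists t.
by move=> es ex; exists (f e) => //; exact: map_f.
Qed.

Lemma link_of_grid n s (D : rect_diagram n) : corners D = grid n s ->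
  link_of R D = edges_set (grid_edges n s).
Proof.
move=> Ds; rewrite /grid_edges !edges_set_cat setUA /link_of Ds.
congr (_ `|` _ `|` _).
- rewrite edges_set_map; apply/seteqP; split=> [q [i [j [k [/and3P[]]]]]|q].
    rewrite !inE => ij ik jk qE; exists (val i, val j, val k).
      by rewrite mem_filter mem_triples !ltn_ord /vertical /= ij ik jk.
    by rewrite /= !emb_lattice seg_coord2// ler_nat ltnW.
  move=> [[[i j] k]]; rewrite mem_filter mem_triples => /andP[/and3P[/= ij ik jk]].
  move=> /and3P[il jl kl]; rewrite !emb_lattice.
  rewrite seg_coord2 ?ler_nat => [qE|]; last exact: ltnW.
  by exists (Ordinal il), (Ordinal jl), (Ordinal kl); rewrite /vedge !inE ij ik jk.
- rewrite edges_set_map; apply/seteqP; split=> [q [j [a [b [/and3P[]]]]]|q].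
    rewrite !inE => aj bj ab qE; exists (val j, val a, val b).
      by rewrite mem_filter mem_triples !ltn_ord /vertical /= !mem_flip aj bj ab.
    by rewrite /= !emb_lattice seg_coord1// ler_nat ltnW.
  move=> [[[j a] b]]; rewrite mem_filter mem_triples /vertical /= !mem_flip.
  move=> /andP[/and3P[/= aj bj ab]].
  move=> /and3P[jl al bl]; rewrite !emb_lattice.
  rewrite seg_coord1 ?ler_nat => [qE|]; last exact: ltnW.
  by exists (Ordinal jl), (Ordinal al), (Ordinal bl); rewrite /hedge !inE aj bj ab.
- rewrite edges_set_map; apply/seteqP; split=> [q [i [j [ij qE]]]|q].
    exists (val i, val j).
      by rewrite mem_filter mem_pairs !ltn_ord; move: ij; rewrite inE /= => ->.
    by rewrite /= !emb_lattice seg_coord3// ler_nat.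
  move=> [[i j]]; rewrite mem_filter mem_pairs => /andP[/= ij /andP[il jl]].
  rewrite !emb_lattice seg_coord3 ?ler_nat// => qE.
  by exists (Ordinal il), (Ordinal jl); rewrite !inE.
Qed.

End GridLink.

Definition cells : seq (nat * nat) :=
  [:: (3, 0); (7, 0); (1, 1); (5, 1); (0, 2); (2, 2); (1, 3); (4, 3); (0, 4);
   (3, 4); (2, 5); (6, 5); (5, 6); (7, 6); (4, 7); (6, 7)].

(** The link of [cells] traversed once around, in quarter units; each corner of the diagram gives
    two vertices, at heights 0 and 4. *)
Definition polygon : seq point :=
  [:: (12, 0, 0); (28, 0, 0); (28, 0, 4); (28, 24, 4); (28, 24, 0); (20, 24, 0);
   (20, 24, 4); (20, 4, 4); (20, 4, 0); (4, 4, 0); (4, 4, 4); (4, 12, 4);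
   (4, 12, 0); (16, 12, 0); (16, 12, 4); (16, 28, 4); (16, 28, 0);
   (24, 28, 0); (24, 28, 4); (24, 20, 4); (24, 20, 0); (8, 20, 0); (8, 20, 4);
   (8, 8, 4); (8, 8, 0); (0, 8, 0); (0, 8, 4); (0, 16, 4); (0, 16, 0);
   (12, 16, 0); (12, 16, 4); (12, 0, 4)].

(* A pair (c, c') moves the vertex c to c'; if c' is the midpoint of its
   neighbours, the vertex disappears.  The list was found by a random search. *)
Definition isotopy_moves : seq (point * point) :=
  [:: ((4, 12, 4), (4, 8, 2)); ((12, 0, 0), (20, 0, 2));
   ((16, 28, 0), (20, 28, 2)); ((28, 24, 0), (24, 24, 2));
   ((4, 4, 0), (12, 4, 2)); ((12, 16, 0), (6, 16, 2));
   ((0, 16, 4), (0, 12, 2)); ((28, 0, 0), (20, 0, 4));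
   ((16, 12, 4), (16, 20, 2)); ((24, 28, 0), (20, 28, 4));
   ((0, 8, 4), (0, 12, 0)); ((20, 4, 4), (20, 14, 2));
   ((12, 0, 4), (10, -2, 6)); ((28, 0, 4), (12, 6, 6));
   ((10, -2, 6), (12, 11, 5)); ((0, 16, 0), (0, 14, -2));
   ((8, 8, 4), (8, 14, 2)); ((0, 8, 0), (4, 11, -1));
   ((16, 12, 0), (14, 16, 0)); ((14, 16, 0), (10, 16, 0));
   ((24, 20, 0), (16, 20, 2)); ((10, 16, 0), (16, 26, 4));
   ((16, 26, 4), (10, 20, 2)); ((16, 28, 4), (18, 24, 6));
   ((24, 28, 4), (21, 22, 5)); ((20, 24, 0), (24, 24, 4));
   ((18, 24, 6), (18, 20, 6)); ((18, 20, 6), (22, 22, 6));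
   ((22, 22, 6), (16, 14, 4)); ((12, 6, 6), (18, 16, 4));
   ((18, 16, 4), (20, 22, 6)); ((28, 24, 4), (20, 23, 5));
   ((20, 22, 6), (16, 20, 4)); ((12, 16, 4), (12, 22, 2));
   ((12, 22, 2), (14, 22, 6)); ((16, 14, 4), (12, 12, 2));
   ((14, 22, 6), (8, 18, 0)); ((8, 18, 0), (10, 19, 1));
   ((20, 24, 4), (12, 18, 2)); ((12, 18, 2), (4, 18, 2));
   ((8, 20, 0), (16, 20, 4)); ((24, 20, 4), (10, 16, 3));
   ((8, 20, 4), (8, 18, 6)); ((8, 18, 6), (8, 14, 6));
   ((8, 14, 6), (10, 10, 1)); ((12, 12, 2), (12, 8, 0));
   ((8, 8, 0), (6, 11, -1)); ((12, 8, 0), (2, 13, -1));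
   ((0, 14, -2), (4, 15, 1)); ((4, 4, 4), (-4, 0, 0));
   ((4, 12, 0), (0, 4, 0)); ((20, 4, 0), (0, -4, 0));
   ((4, 18, 2), (4, 0, 0))].

Definition cells_diagram : rect_diagram 8 :=
  RectDiagram (@card_column_grid 8 cells isT) (@card_row_grid 8 cells isT).

Lemma trivial_cells (R : realType) : trivial_knot (link_of R cells_diagram).
Proof.
apply: isotopic_ambient; rewrite (@link_of_grid R 8 cells)//.
rewrite (@same_edges_set _ _ (zip polygon (rot 1 polygon))); last by vm_compute.
apply: isotopic_trans (diamond_isotopic R).
by apply: (@run_isotopic _ _ isotopy_moves); vm_compute.
Qed.

Theorem theorem1p2 (R : realType) :
  exists (n : nat) (D : rect_diagram n),
    trivial_knot (link_of R D) /\
    forall (s : seq move_kind) (T : rect_diagram 2),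
      moves s D T -> has is_exterior_exchange s.
Proof.
exists 8%N, cells_diagram; split; first exact: trivial_cells.
move=> s T sT.
have /andP[rc rfc] : rigid 8 cells && rigid 8 (flip cells) by vm_compute.
exact: (rigid_moves sT (erefl (grid 8 cells)) rc rfc).
Qed.
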